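(* Let $\{n_k\}_{k=1}^\infty$ be a strictly increasing sequence of positive integers and let $\tau=\{t_k\}_{k=1}^\infty$, $t_k\in[0,1]$, be a weakness sequence such that $$\sum_{k=1}^\infty\frac{(n_{k+1}-n_k)^{1/2}\,t_{n_k}}{n_k}=\infty,\qquad \frac{n_{k+1}}{n_k}\le C_0,\quad k=1,2,\dots,$$ with a constant $C_0$. Then for any real Hilbert space $H$, any dictionary $\mathcal{D}$ in $H$, any $f\in H$, and any realization of the Weak Greedy Algorithm WGA($\mathcal{D},\tau$) applied to $f$, $$\lim_{m\to\infty}\|f-G_m^\tau(f,\mathcal{D})\|=0.$$
   Context: $H$ is a real Hilbert space with inner product $\langle\cdot,\cdot\rangle$ and norm $\|x\|=\langle x,x\rangle^{1/2}$. A dictionary is a set $\mathcal{D}\subset H$ such that $\|g\|=1$ for every $g\in\mathcal{D}$ and the closed linear span of $\mathcal{D}$ is $H$. Weak Greedy Algorithm WGA($\mathcal{D},\tau$): given $f\in H$, put $f_0=f$. For each $m\ge1$: (i) $\varphi_m\in\mathcal{D}$ is any element satisfying $|\langle f_{m-1},\varphi_m\rangle|\ge t_m\sup_{g\in\mathcal{D}}|\langle f_{m-1},g\rangle|$ (if $t_m=1$ it is assumed that such a maximizer exists); (ii) $f_m=f_{m-1}-\langle f_{m-1},\varphi_m\rangle\varphi_m$; (iii) $G^\tau_m(f,\mathcal{D})=\sum_{j=1}^m\langle f_{j-1},\varphi_j\rangle\varphi_j$. Thus $f_m=f-G^\tau_m(f,\mathcal{D})$. A realization is any outcome of admissible choices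 of the $\varphi_m$. *)

(* Defs.v *)
From HB Require Import structures.
From mathcomp Require Import all_boot all_order all_algebra.
From mathcomp Require Import all_classical all_reals all_analysis.

Set Implicit Arguments.
Unset Strict Implicit.
Unset Printing Implicit Defensive.

Import Order.TTheory GRing.Theory Num.Theory.
Import numFieldNormedType.Exports.

Local Open Scope classical_set_scope.
Local Open Scope ring_scope.

Section WeakGreedyAlgorithm.
Context {R : realType} {H : completeNormedModType R}.
Implicit Types (dot : {dot H for idfun}) (D : set H) (f : H).

(* A real Hilbert space is a complete normed module over R together with a
   (symmetric, positive definite) form dot satisfying norm_induced_by dot. *)
Definition norm_induced_by dot : Prop :=
  forall x : H, `|x| = Num.sqrt (dot x x).

Definition linear_span D : set H :=
  [set v | exists (N : nat) (c : 'I_N -> R) (g : 'I_N -> H),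
      (forall i, D (g i)) /\ v = \sum_(i < N) c i *: g i].

Definition dictionary D : Prop :=
  (forall g, D g -> `|g| = 1) /\ closure (linear_span D) = setT.

(* All sequences below are indexed from 1: the value at 0 of the chosen
   elements phi and of the weakness sequence t is never used. *)
Fixpoint greedy_residual dot f (phi : nat -> H) (m : nat) : H :=
  if m is m'.+1 then
    let r := greedy_residual dot f phi m' in r - dot r (phi m) *: phi m
  else f.

Definition greedy_approximant dot f (phi : nat -> H) (m : nat) : H :=
  \sum_(1 <= j < m.+1) dot (greedy_residual dot f phi j.-1) (phi j) *: phi j.

(* The supremum is taken in R; it is a genuine one for a nonempty dictionary,
   by Cauchy-Schwarz. *)
Definition WGA_realization dot D (t : nat -> R) f (phi : nat -> H) : Prop :=
  forall m : nat, (1 <= m)%N ->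
    D (phi m) /\
    t m * sup [set `|dot (greedy_residual dot f phi m.-1) g| | g in D]
      <= `|dot (greedy_residual dot f phi m.-1) (phi m)|.

End WeakGreedyAlgorithm.

(* Main.v *)
(* Write f_m for the residuals, a_m for the absolute value of the m-th greedy
   coefficient and S_m = a_1 + ... + a_m; then a is square summable. If
   c t_{n_k} <= a_{n_k} S_{n_k} held for all large k, then AM-GM would bound
   c (n_{k+1} - n_k)^(1/2) t_{n_k} / n_k by
   a_{n_k}^2 + (n_{k+1} - n_k) (S_{n_k} / n_k)^2, which is summable by Hardy's
   inequality since n_{k+1} <= C0 n_k. Hence sup_g |<f_m, g>| * S_{m+1} is
   arbitrarily small along m = n_k - 1. Testing f_m against f itself,
   |f_m|^2 = <f_m, f> - <f_m, G_m>: the second term is at most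
   S_m sup_g |<f_m, g>|, and the first is small because f is approximated by
   the span of D. So |f_m|, which is nonincreasing, tends to 0. *)
Require Import Defs.
From mathcomp Require Import all_boot all_order all_algebra.
From mathcomp Require Import all_classical all_reals all_analysis.
From mathcomp Require Import ring lra.

Set Implicit Arguments.
Unset Strict Implicit.
Unset Printing Implicit Defensive.

Import Order.TTheory GRing.Theory Num.Theory.
Import numFieldNormedType.Exports.

Local Open Scope classical_set_scope.
Local Open Scope ring_scope.

(** * Hardy's inequality for exponent 2, and sums along the sequence [n] *)

Lemma hardy_sum_sqr_mean (R : realFieldType) (a : nat -> R) (N : nat) :
  \sum_(i < N) ((\sum_(j < i.+1) a j) / i.+1%:R) ^+ 2
    <= 4 * \sum_(i < N) a i ^+ 2.
Proof.
(* The added term makes the induction step an algebraic identity (keyE). *)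
suff: \sum_(i < N) ((\sum_(j < i.+1) a j) / i.+1%:R) ^+ 2
    + 2 * N%:R * ((\sum_(j < N) a j) / N%:R) ^+ 2 <= 4 * \sum_(i < N) a i ^+ 2.
  by move=> h; apply: le_trans h; rewrite lerDl mulr_ge0 ?sqr_ge0 ?mulr_ge0.
elim: N => [|N IH]; first by rewrite !big_ord0 !mul0r expr0n /= !mulr0 addr0.
rewrite big_ord_recr /= [X in _ <= 4 * X]big_ord_recr /=.
set A := (\sum_(j < N.+1) a j) / _; set B := (\sum_(j < N) a j) / _ in IH.
have aE : a N = N.+1%:R * A - N%:R * B.
  have hA : N.+1%:R * A = \sum_(j < N.+1) a j.
    by rewrite /A mulrC divfK // pnatr_eq0.
  have hB : N%:R * B = \sum_(j < N) a j.
    rewrite /B; case: (N) => [|N']; first by rewrite mul0r big_ord0.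
    by rewrite mulrC divfK // pnatr_eq0.
  by rewrite hA hB big_ord_recr /= addrAC subrr add0r.
have keyE : 4 * a N ^+ 2 + 2 * N%:R * B ^+ 2
    - (A ^+ 2 + 2 * N.+1%:R * A ^+ 2)
    = (A - 2 * a N) ^+ 2 + 2 * N%:R * (A - B) ^+ 2.
  by rewrite aE -natr1; ring.
have key : 0 <= (A - 2 * a N) ^+ 2 + 2 * N%:R * (A - B) ^+ 2.
  by rewrite addr_ge0 ?sqr_ge0 // mulr_ge0 ?sqr_ge0 ?mulr_ge0.
rewrite -keyE in key; lra.
Qed.

(** The index blocks [[n k - 1, n k.+1 - 1)] are adjacent, so the bounds add up; nonnegativity of
    [u] absorbs the indices before the first block. *)
Lemma sum_blocks_le (R : numDomainType) (n : nat -> nat) (F u : nat -> R)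
  (n_incr : forall k, (1 <= k)%N -> (n k < n k.+1)%N)
  (u_ge0 : forall i, 0 <= u i)
  (F_le : forall k, (1 <= k)%N ->
    F k <= \sum_((n k).-1 <= i < (n k.+1).-1) u i) (N : nat) :
  (1 <= N)%N -> \sum_(1 <= k < N) F k <= \sum_(0 <= i < (n N).-1) u i.
Proof.
elim: N => // -[_ _|N IH _]; first by rewrite big_geq // sumr_ge0.
rewrite big_nat_recr //= [leRHS](@big_cat_nat _ _ _ (n N.+1).-1) //=.
  by rewrite lerD ?IH ?F_le.
by rewrite -!subn1 leq_sub2r // ltnW // n_incr.
Qed.

(** AM-GM bounds each term by [a m ^+ 2 + d * A m ^+ 2], with [m = n k - 1], [d = n k.+1 - n k] and
    [A] the running means. Both parts are spread over the k-th block, and Hardy's inequality sums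
    the means. *)
Lemma sum_lacunary_le (R : realType) (n : nat -> nat) (a : nat -> R) (B C0 : R)
  (n_pos : forall k, (1 <= k)%N -> (0 < n k)%N)
  (n_incr : forall k, (1 <= k)%N -> (n k < n k.+1)%N)
  (ratio_le : forall k, (1 <= k)%N -> (n k.+1)%:R / (n k)%:R <= C0)
  (a_ge0 : forall i, 0 <= a i)
  (a_le : forall N, \sum_(0 <= i < N) a i ^+ 2 <= B) (N : nat) :
  \sum_(1 <= k < N) Num.sqrt ((n k.+1)%:R - (n k)%:R)
      * (a (n k).-1 * \sum_(i < n k) a i) / (n k)%:R
    <= B + C0 ^+ 2 * (4 * B).
Proof.
set A := fun i => (\sum_(j < i.+1) a j) / i.+1%:R.
set u := fun i => a i ^+ 2 + C0 ^+ 2 * A i ^+ 2.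
have u_ge0 i : 0 <= u i by rewrite addr_ge0 ?sqr_ge0 // mulr_ge0 ?sqr_ge0.
have B_ge0 : 0 <= B by apply: le_trans (a_le 0%N); rewrite big_geq.
case: N => [|N].
  by rewrite big_geq // addr_ge0 // mulr_ge0 ?sqr_ge0 // mulr_ge0.
apply: (@le_trans _ _ (\sum_(0 <= i < (n N.+1).-1) u i)); last first.
  rewrite big_split /= -mulr_sumr lerD // ler_wpM2l ?sqr_ge0 //.
  apply: le_trans (_ : 4 * \sum_(0 <= i < (n N.+1).-1) a i ^+ 2 <= _).
    by rewrite !big_mkord; apply: hardy_sum_sqr_mean.
  by rewrite ler_wpM2l.
apply: sum_blocks_le => // k k1.
have nk0 := n_pos k k1; have nkS := n_incr k k1.
have nkR : 0 < (n k)%:R :> R by rewrite ltr0n.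
set m := (n k).-1.
have mE : n k = m.+1 by rewrite prednK.
set d := (n k.+1)%:R - (n k)%:R.
have d_ge0 : 0 <= d by rewrite subr_ge0 ler_nat ltnW.
(* Partial sums grow with [i], while the denominator grows by a factor at most [C0] inside a
   block. *)
have A_block i : (m <= i < (n k.+1).-1)%N -> A m ^+ 2 <= C0 ^+ 2 * A i ^+ 2.
  case/andP=> mi ik; rewrite -exprMn; apply: lerXn2r; rewrite ?nnegrE.
  - by rewrite divr_ge0 ?sumr_ge0.
  - rewrite mulr_ge0 ?divr_ge0 ?sumr_ge0 //.
    by apply: le_trans (ratio_le k k1); rewrite divr_ge0.
  have i0 : 0 < i.+1%:R :> R by rewrite ltr0n.
  have m0 : 0 < m.+1%:R :> R by rewrite ltr0n.
  have S_le : \sum_(j < m.+1) a j <= \sum_(j < i.+1) a j.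
    rewrite -!(big_mkord xpredT a) [leRHS](@big_cat_nat _ _ _ m.+1) //=.
    by rewrite lerDl sumr_ge0.
  have i_le : i.+1%:R <= C0 * m.+1%:R.
    rewrite -mE -ler_pdivrMr //; apply: le_trans (ratio_le k k1).
    rewrite ler_pM2r ?invr_gt0 // ler_nat.
    by case: (n k.+1) ik => //= p /ltnW.
  rewrite /A; apply: le_trans (_ : (\sum_(j < i.+1) a j) / m.+1%:R <= _).
    by rewrite ler_wpM2r ?invr_ge0.
  rewrite mulrCA ler_wpM2l ?sumr_ge0 // ler_pdivlMr //.
  by rewrite mulrC ler_pdivrMr.
have block : d * A m ^+ 2 <= \sum_(m <= i < (n k.+1).-1) C0 ^+ 2 * A i ^+ 2.
  (* The block has exactly [d] indices, so the factor [d] becomes a sum of constants. *)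
  have -> : d * A m ^+ 2 = \sum_(m <= i < (n k.+1).-1) A m ^+ 2.
    rewrite sumr_const_nat -mulr_natl /d -natrB ?(ltnW nkS) //.
    by rewrite /m -!subn1 subnBA // subnK // (leq_trans _ nkS).
  by apply: ler_sum_nat.
have a_block : a m ^+ 2 <= \sum_(m <= i < (n k.+1).-1) a i ^+ 2.
  rewrite big_ltn; last by rewrite /m -!subn1 ltn_sub2r // (leq_trans _ nkS).
  by rewrite lerDl sumr_ge0 // => i _; rewrite sqr_ge0.
rewrite big_split /=; apply: le_trans (lerD a_block block).
set q := Num.sqrt d * A m.
have -> : Num.sqrt d * (a m * \sum_(i < n k) a i) / (n k)%:R = a m * q.
  by rewrite /q /A -mE mulrCA !mulrA.
have -> : d * A m ^+ 2 = q ^+ 2 by rewrite [RHS]exprMn sqr_sqrtr.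
have := sqr_ge0 (q - a m); have := sqr_ge0 (a m); have := sqr_ge0 q.
nra.
Qed.

(** Otherwise [t (n k)] is at most [c^-1] times [a m * \sum_(i < m.+1) a i] at [m = n k - 1] for all
    large [k], and the divergent series is dominated by a bounded one. *)
Lemma lacunary_liminf0 (R : realType) (n : nat -> nat) (t a : nat -> R)
  (B C0 : R)
  (n_pos : forall k, (1 <= k)%N -> (0 < n k)%N)
  (n_incr : forall k, (1 <= k)%N -> (n k < n k.+1)%N)
  (sum_diverges :
    (\sum_(1 <= k < N)
        Num.sqrt ((n k.+1)%:R - (n k)%:R) * t (n k) / (n k)%:R : R)
      @[N --> \oo] --> +oo)
  (ratio_le : forall k, (1 <= k)%N -> (n k.+1)%:R / (n k)%:R <= C0)
  (a_ge0 : forall i, 0 <= a i)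
  (a_le : forall N, \sum_(0 <= i < N) a i ^+ 2 <= B) (c : R) (K : nat) :
  0 < c -> exists m, [/\ (K <= m)%N &
    a m * \sum_(i < m.+1) a i < c * t m.+1].
Proof.
move=> c0; apply/not_existsP => noM.
have n_ge k : (k <= n k)%N.
  elim: k => // -[|k] IH; first exact: n_pos.
  by rewrite (leq_ltn_trans IH) ?n_incr.
have t_le k : (K < k)%N -> t (n k) <= c^-1 * (a (n k).-1 * \sum_(i < n k) a i).
  move=> Kk; have k1 : (1 <= k)%N by exact: leq_ltn_trans Kk.
  have := noM (n k).-1; rewrite prednK ?n_pos // => hno.
  rewrite mulrC ler_pdivlMr // mulrC leNgt; apply/negP => lt_t; apply: hno.
  by split => //; rewrite -ltnS prednK ?n_pos // (leq_trans Kk).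
set w := fun k => Num.sqrt ((n k.+1)%:R - (n k)%:R) : R.
set s := fun k => a (n k).-1 * \sum_(i < n k) a i.
(* Bound for all late partial sums: the first [K] terms are kept as they are, the tail is at most
   [c^-1] times the full lacunary sum. *)
set C := \sum_(1 <= k < K.+1) w k * t (n k) / (n k)%:R
         + c^-1 * (B + C0 ^+ 2 * (4 * B)).
have /cvgryPge /(_ (C + 1)) [N0 _ hN0] := sum_diverges.
have := hN0 (maxn N0 K.+1) (leq_maxl _ _).
set N := maxn _ _; have KN : (K.+1 <= N)%N by rewrite leq_maxr.
suff : \sum_(1 <= k < N) w k * t (n k) / (n k)%:R <= C by rewrite /w /=; lra.
rewrite (@big_cat_nat _ _ _ K.+1) //= lerD2l.
have s_ge0 k : 0 <= w k * s k / (n k)%:R.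
  by rewrite divr_ge0 // mulr_ge0 ?sqrtr_ge0 // mulr_ge0 ?sumr_ge0.
apply: le_trans (_ : c^-1 * \sum_(1 <= k < N) w k * s k / (n k)%:R <= _);
  last by rewrite ler_pM2l ?invr_gt0 //; exact: sum_lacunary_le.
rewrite [X in _ * X](@big_cat_nat _ _ _ K.+1) //= mulrDr.
rewrite -[leLHS]add0r lerD //.
  by rewrite mulr_ge0 ?sumr_ge0 // invr_ge0 ltW.
rewrite mulr_sumr; apply: ler_sum_nat => k /andP[Kk _].
rewrite mulrA ler_wpM2r ?invr_ge0 // mulrCA ler_wpM2l ?sqrtr_ge0 //.
exact: t_le.
Qed.

(** * Inner product calculus *)

Section RealHilbert.
Context {R : realType} {H : completeNormedModType R}.
Context {dot : {dot H for idfun}} (dot_norm : norm_induced_by dot).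
Implicit Types x y : H.

Lemma dotC x y : dot x y = dot y x.
Proof. by rewrite hermC expr0 mul1r. Qed.

Lemma dotxx x : dot x x = `|x| ^+ 2.
Proof.
rewrite dot_norm sqr_sqrtr //; have [->|x0] := eqVneq x 0.
  by rewrite linear0l.
by rewrite ltW // neq0_dnorm_gt0.
Qed.

Lemma dotZl c x y : dot (c *: x) y = c * dot x y.
Proof. exact: linearZl_LR. Qed.

Lemma dotZr c x y : dot x (c *: y) = c * dot x y.
Proof. exact: linearZr_LR. Qed.

Lemma dot_sumZr N (c : 'I_N -> R) (g : 'I_N -> H) x :
  dot x (\sum_(i < N) c i *: g i) = \sum_(i < N) c i * dot x (g i).
Proof. by rewrite linear_sumr; apply: eq_bigr => i _; exact: dotZr. Qed.

Lemma normB_sqr x y : `|x - y| ^+ 2 = `|x| ^+ 2 - 2 * dot x y + `|y| ^+ 2.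
Proof.
rewrite -!dotxx linearBl /= !linearBr /= (dotC y x); ring.
Qed.

Lemma dot_CauchySchwarz x y : `|dot x y| <= `|x| * `|y|.
Proof.
have [->|y0] := eqVneq y 0; first by rewrite linear0r !normr0 mulr0.
have y2 : 0 < `|y| ^+ 2 by rewrite exprn_gt0 // normr_gt0.
rewrite -(@ler_pXn2r _ 2) ?nnegrE ?mulr_ge0 // exprMn real_normK ?num_real //.
(* The squared norm of this vector is [|y|^2 (|x|^2 |y|^2 - (dot x y)^2)]. *)
have := sqr_ge0 `|(`|y| ^+ 2) *: x - dot x y *: y|.
rewrite normB_sqr !normrZ dotZr dotZl !exprMn.
rewrite !real_normK ?num_real // => h.
rewrite -(ler_pM2l y2); lra.
Qed.

End RealHilbert.

(** * Greedy residuals and coefficients *)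

Section WeakGreedy.
Context {R : realType} {H : completeNormedModType R}.
Context {dot : {dot H for idfun}} (dot_norm : norm_induced_by dot).
Context {D : set H} (D_unit : forall g, D g -> `|g| = 1).
Context (f : H) {phi : nat -> H}.
Local Notation r := (greedy_residual dot f phi).
(** Shifted to start at 0: [a i] is the size of the coefficient chosen at step [i.+1]. *)
Local Notation a := (fun i => `|dot (r i) (phi i.+1)|).

Lemma greedy_residualE m : r m = f - greedy_approximant dot f phi m.
Proof.
rewrite /greedy_approximant; elim: m => [|m IH].
  by rewrite big_geq ?subr0.
by rewrite big_nat_recr //= opprD addrA -IH.
Qed.

(** Serves both for an element of the span close to [f] and for the greedy approximant itself. *)
Lemma dot_span_le (v x : H) (N : nat) (c : 'I_N -> R) (g : 'I_N -> H) (s : R) :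
  v = \sum_(i < N) c i *: g i -> (forall i, `|dot x (g i)| <= s) ->
  `|dot x v| <= (\sum_(i < N) `|c i|) * s.
Proof.
move=> -> hs; rewrite dot_sumZr mulr_suml.
apply: le_trans (ler_norm_sum _ _ _) _; apply: ler_sum => i _.
by rewrite normrM ler_wpM2l.
Qed.

Lemma dot_greedy_approximant_le m x s : (forall i, `|dot x (phi i.+1)| <= s) ->
  `|dot x (greedy_approximant dot f phi m)| <= (\sum_(i < m) a i) * s.
Proof.
move=> hs; rewrite /greedy_approximant big_add1 /= big_mkord.
have := @dot_span_le _ x _ _ _ s (erefl _) (fun i : 'I_m => hs i).
exact.
Qed.

(** Cauchy-Schwarz bounds the set by the norm of [x], so [sup] is a true supremum and not its
    default value. *)
Lemma le_dot_sup x g : D g -> `|dot x g| <= sup [set `|dot x h| | h in D].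
Proof.
move=> Dg; apply: ub_le_sup; last by exists g.
exists `|x| => _ [h Dh <-].
apply: le_trans (dot_CauchySchwarz dot_norm _ _) _.
by rewrite (@D_unit _ Dh) mulr1.
Qed.

Context (phi_D : forall m, D (phi m.+1)).

(** Pythagoras: the new residual is orthogonal to the unit vector just chosen. *)
Lemma norm_greedy_residualS m : `|r m.+1| ^+ 2 = `|r m| ^+ 2 - a m ^+ 2.
Proof.
rewrite /= (normB_sqr dot_norm) dotZr normrZ (@D_unit _ (phi_D m)).
rewrite mulr1 real_normK ?num_real //; ring.
Qed.

Lemma norm_greedy_residual_nonincr m k :
  (m <= k)%N -> `|r k| <= `|r m|.
Proof.
move=> /subnK <-; elim: (k - m)%N => // j; apply: le_trans.
rewrite addSn -(@ler_pXn2r _ 2) ?nnegrE // norm_greedy_residualS.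
by rewrite gerBl sqr_ge0.
Qed.

Lemma sum_sqr_greedy_coef_le m : \sum_(0 <= i < m) a i ^+ 2 <= `|f| ^+ 2.
Proof.
suff -> : \sum_(0 <= i < m) a i ^+ 2 = `|f| ^+ 2 - `|r m| ^+ 2.
  by rewrite gerBl sqr_ge0.
elim: m => [|m IH]; first by rewrite big_geq ?subrr.
by rewrite big_nat_recr //= IH norm_greedy_residualS; ring.
Qed.

End WeakGreedy.

Theorem theorem5p6 (R : realType) (n : nat -> nat) (t : nat -> R) (C0 : R)
  (n_pos : forall k : nat, (1 <= k)%N -> (0 < n k)%N)
  (n_incr : forall k : nat, (1 <= k)%N -> (n k < n k.+1)%N)
  (t_01 : forall k : nat, (1 <= k)%N -> 0 <= t k <= 1)
  (sum_diverges :
    (\sum_(1 <= k < N)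
        Num.sqrt ((n k.+1)%:R - (n k)%:R) * t (n k) / (n k)%:R : R)
      @[N --> \oo] --> +oo)
  (ratio_le : forall k : nat, (1 <= k)%N -> (n k.+1)%:R / (n k)%:R <= C0)
  (H : completeNormedModType R) (dot : {dot H for idfun})
  (dot_norm : norm_induced_by dot)
  (D : set H) (D_dict : dictionary D) (f : H)
  (phi : nat -> H) (phi_WGA : WGA_realization dot D t f phi) :
  `|f - greedy_approximant dot f phi m| @[m --> \oo] --> (0 : R).
Proof.
have [D_unit D_dense] := D_dict.
set r := greedy_residual dot f phi.
set a := fun i => `|dot (r i) (phi i.+1)|.
set S := fun m => \sum_(i < m) a i.
set sigma := fun m => sup [set `|dot (r m) g| | g in D].
have phi_D m : D (phi m.+1) by case: (phi_WGA m.+1 isT).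
have t_sigma m : t m.+1 * sigma m <= a m by case: (phi_WGA m.+1 isT).
have sigma_ge m g : D g -> `|dot (r m) g| <= sigma m.
  exact: le_dot_sup.
have sigma_ge0 m : 0 <= sigma m.
  exact: le_trans (sigma_ge m _ (phi_D m)).
have a_ge0 i : 0 <= a i by exact: normr_ge0.
have S_mono m k : (m <= k)%N -> S m <= S k.
  move=> mk; rewrite /S -!(big_mkord xpredT a).
  by rewrite [leRHS](@big_cat_nat _ _ _ m) //= lerDl sumr_ge0.
(* The strict inequality forces [t m.+1] to be positive, since its left side is nonnegative; this
   permits division by it. *)
have liminf0 c K : 0 < c ->
    exists m, [/\ (K <= m)%N, 0 < t m.+1 & a m * S m.+1 < c * t m.+1].
  move=> c0; have [m [Km lt_m]] := lacunary_liminf0 n_pos n_incr sum_diverges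
    ratio_le a_ge0 (sum_sqr_greedy_coef_le dot_norm D_unit f phi_D) K c0.
  exists m; split => //; rewrite -(pmulr_rgt0 _ c0); apply: le_lt_trans lt_m.
  by rewrite mulr_ge0 ?sumr_ge0.
(* If some [S j] is positive, the target [min c (c * S j)] with [m >= j] controls [sigma m] as well.
   Otherwise every coefficient vanishes, and a positive [t m.+1] gives [sigma m = 0]. *)
have small c : 0 < c -> exists m, S m * sigma m <= c /\ sigma m <= c.
  move=> c0; have [/existsNP[j /negP Sj]|S0] := pselect (~ forall j, S j <= 0).
    rewrite -ltNge in Sj.
    have c'0 : 0 < Num.min c (c * S j) by rewrite lt_min c0 mulr_gt0.
    have [m [jm t0 lt_m]] := liminf0 _ j c'0; exists m.
    have Ss : S m.+1 * sigma m <= Num.min c (c * S j).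
      rewrite -(ler_pM2l t0) mulrCA; apply: le_trans (_ : S m.+1 * a m <= _).
        by rewrite ler_wpM2l ?sumr_ge0.
      by rewrite mulrC (le_trans (ltW lt_m)) // mulrC.
    move: Ss; rewrite le_min => /andP[Ss Ssj]; split.
      by apply: le_trans Ss; rewrite ler_wpM2r // S_mono.
    rewrite -(ler_pM2r Sj); apply: le_trans Ssj; rewrite mulrC ler_wpM2r //.
    by rewrite S_mono // (leq_trans jm).
  move/contrapT: S0 => S0; have [m [_ t0 _]] := liminf0 _ 0%N c0; exists m.
  have am0 : a m <= 0.
    by apply: le_trans (S0 m.+1); rewrite /S big_ord_recr /= lerDr sumr_ge0.
  have s0 : sigma m <= 0.
    by rewrite -(ler_pM2l t0) mulr0 (le_trans (t_sigma m)).
  split; last by rewrite (le_trans s0) // ltW.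
  by rewrite (le_trans _ (ltW c0)) // mulr_ge0_le0 ?sumr_ge0.
have norm_small e : 0 < e -> exists m, `|r m| ^+ 2 <= e.
  (* The budget is [e = |f| d + 2 d]: the first part pays for [f - v], the rest for [v] and the
     approximant. *)
  move=> e0; pose d := e / (`|f| + 2).
  have f2 : 0 < `|f| + 2 by rewrite ltr_wpDl.
  have d0 : 0 < d by rewrite divr_gt0.
  have : closure (linear_span D) f by rewrite D_dense.
  move=> /(_ _ (nbhsx_ballx f d d0)) [v [[N [c [g [Dg vE]]]]]].
  rewrite -ball_normE /= => fv.
  set C := \sum_(i < N) `|c i|.
  have C_ge0 : 0 <= C by rewrite sumr_ge0.
  (* With this threshold both [C * sigma m] and [S m * sigma m] are at most [d]; adding 1 covers
     [C = 0]. *)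
  have c0 : 0 < d / (C + 1) by rewrite divr_gt0 // ltr_wpDl.
  have [m [Ss s_le]] := small _ c0; exists m.
  have dC : d / (C + 1) * (C + 1) = d by rewrite divfK // gt_eqF // ltr_wpDl.
  have rE : `|r m| ^+ 2 = dot (r m) (f - v) + dot (r m) v
      - dot (r m) (greedy_approximant dot f phi m).
    by rewrite -(dotxx dot_norm) {2}/r greedy_residualE !linearBr /=; ring.
  have h1 : `|dot (r m) (f - v)| <= `|f| * d.
    apply: le_trans (dot_CauchySchwarz dot_norm _ _) _.
    apply: ler_pM => //; last exact: ltW.
    exact: (norm_greedy_residual_nonincr dot_norm D_unit f phi_D (leq0n m)).
  have h2 : `|dot (r m) v| <= C * sigma m.
    by apply: (dot_span_le vE) => i; apply: sigma_ge.
  have h3 : `|dot (r m) (greedy_approximant dot f phi m)| <= S m * sigma m.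
    by apply: dot_greedy_approximant_le => i; apply: sigma_ge.
  have h4 : C * sigma m <= C * (d / (C + 1)) by rewrite ler_wpM2l.
  have eE : e = `|f| * d + 2 * d by rewrite -mulrDl mulrC divfK // gt_eqF.
  have := ler_norm (dot (r m) (f - v)); have := ler_norm (dot (r m) v).
  have := ler_norm (- dot (r m) (greedy_approximant dot f phi m)).
  rewrite normrN rE eE; lra.
(* One small residual suffices, because the norms are nonincreasing. *)
apply/cvgrPdist_le => e e0.
have [M hM] := norm_small _ (exprn_gt0 2 e0).
exists M => // m /= Mm; rewrite sub0r normrN normr_id -greedy_residualE.
apply: le_trans (norm_greedy_residual_nonincr dot_norm D_unit f phi_D Mm) _.
by rewrite -(@ler_pXn2r _ 2) ?nnegrE // ltW.
Qed.
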